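(* Let $\mathcal{A}=((V_i)_{1\le i\le n},E)$ be an $n$-player arena (with a possibly infinite vertex set $V$), let $T_1,\dots,T_n\subseteq V$ and let $\mathcal{G}=(\mathcal{A},(\mathsf{Safe}(T_i))_{1\le i\le n})$ be the associated safety game. Let $\sigma'$ be a Nash equilibrium from a vertex $v_0$ in $\mathcal{G}$, with outcome $\pi'=\mathsf{Out}(\sigma',v_0)$. Then there exists a finite-memory Nash equilibrium $\sigma$ from $v_0$ in $\mathcal{G}$ such that $\mathsf{SatPl}(\pi')\subseteq\mathsf{SatPl}(\mathsf{Out}(\sigma,v_0))$ and each strategy of $\sigma$ has a memory size of at most $$\max\{1,\,n-|\mathsf{SatPl}(\pi')|\}\cdot(|\mathsf{VisPos}(\pi')\setminus\{0\}|+2)\ \le\ n^2+2n .$$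
   Context: Arenas. An $n$-player arena ($n\ge 1$) is $\mathcal{A}=((V_i)_{1\le i\le n},E)$ where $V$ is a (possibly infinite) set of vertices, $(V_i)_{1\le i\le n}$ is a partition of $V$ (parts may be empty; $V_i$ is the set of vertices controlled by player $P_i$), $E\subseteq V\times V$, and every vertex has at least one $E$-successor. A play is an infinite sequence $v_0v_1\ldots$ with $(v_\ell,v_{\ell+1})\in E$ for all $\ell\in\mathbb{N}$; a history is a finite non-empty prefix of a play. Strategies. A strategy of $P_i$ is a function $\sigma_i$ mapping each history $h$ ending in $V_i$ to an $E$-successor of the last vertex of $h$. A strategy profile is a tuple $\sigma=(\sigma_i)_{1\le i\le n}$ with one strategy per player. A play $v_0v_1\ldots$ is consistent with $\sigma_i$ if $v_\ell\in V_i$ implies $v_{\ell+1}=\sigma_i(v_0\ldots v_\ell)$ for all $\ell$. $\mathsf{Out}(\sigma,v_0)$ is the unique play from $v_0$ consistent with all strategies of $\sigma$. Finite memory. A Mealy machine of $P_i$ is $(M,m_{\mathsf{init}},\mathsf{up},\mathsf{nxt}_i)$ with $M$ a finite set, $m_{\mathsf{init}}\in M$, $\mathsf{up}\colon M\times V\to M$ and $\mathsf{nxt}_i\colon M\times V_i\to V$. Let $\widehat{\mathsf{up}}(\varepsilon)=m_{\mathsf{init}}$ and $\widehat{\mathsf{up}}(wv)=\mathsf{up}(\widehat{\mathsf{up}}(w),v)$ for $w\in V^*$, $v\in V$. The machine induces the strategy $\sigma_i(h'v)=\mathsf{nxt}_i(\widehat{\mathsf{up}}(h'),v)$ for every history $h'v$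 ending in $v\in V_i$ (with $h'\in V^*$ possibly empty). A strategy is finite-memory if it is induced by a Mealy machine, and has memory size at most $b$ if it is induced by some Mealy machine with $|M|\le b$. A strategy profile is finite-memory if all its strategies are. Objectives and equilibria. $\mathsf{Safe}(T)$ is the set of plays in which no vertex of $T$ occurs; the objective of $P_i$ in $\mathcal{G}$ is $\mathsf{Safe}(T_i)$. For a play $\pi=v_0v_1\ldots$, $\mathsf{SatPl}(\pi)=\{i\mid \pi\in\mathsf{Safe}(T_i)\}$, and $\mathsf{VisPos}(\pi)=\{\min\{\ell\in\mathbb{N}\mid v_\ell\in T_i\}\mid 1\le i\le n,\ T_i\text{ is visited in }\pi\}$ is the set of earliest positions at which the sets $T_i$ are visited along $\pi$. A strategy profile $\sigma$ is a Nash equilibrium from $v_0$ if no player whose objective is not satisfied by $\mathsf{Out}(\sigma,v_0)$ has a strategy such that, when this player alone replaces their strategy in $\sigma$ by it, the outcome from $v_0$ satisfies their objective. *)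

(* Defs.v *)
From mathcomp Require Import all_boot finmap.
From mathcomp Require Import boolp classical_sets functions cardinality.

Set Implicit Arguments.
Unset Strict Implicit.
Unset Printing Implicit Defensive.

(* The partition (V_i)_i is given by the function mapping a vertex to the
   player controlling it; no surjectivity, as parts may be empty. *)
Record arena (n : nat) := Arena {
  vertex :> Type;
  owner : vertex -> 'I_n;
  edge : vertex -> vertex -> Prop;
  edge_total : forall v, exists w, edge v w }.
Arguments owner {n a} v.
Arguments edge {n a} v w.

Section Arena.
Variables (n : nat) (A : arena n).
Implicit Types (i : 'I_n) (v : A) (w h : seq A) (pi : nat -> A).

Definition is_play pi := forall l, edge (pi l) (pi l.+1).

Definition is_history h := exists pi l, is_play pi /\ h = mkseq pi l.+1.

(* The values of a strategy of player i outside the histories ending in V_i are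
   irrelevant: no definition below refers to them. *)
Record strategy i := Strategy {
  strategy_fun :> seq A -> A;
  strategyP : forall w v, is_history (rcons w v) -> owner v = i ->
    edge v (strategy_fun (rcons w v)) }.

Definition profile := forall i, strategy i.

Definition consistent i (s : strategy i) pi :=
  forall l, owner (pi l) = i -> pi l.+1 = s (mkseq pi l.+1).

Fixpoint outcome_history (s : profile) v0 (l : nat) : seq A :=
  if l is k.+1 then
    let h := outcome_history s v0 k in rcons h (s (owner (last v0 h)) h)
  else [:: v0].

(* See outcomeP for the characterization as the unique consistent play. *)
Definition outcome (s : profile) v0 (l : nat) : A :=
  last v0 (outcome_history s v0 l).

Record mealy i := Mealy {
  mstate : finType;
  minit : mstate;
  mup : mstate -> A -> mstate;
  mnxt : mstate -> forall v, owner v = i -> A }.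

Definition mup_hat i (M : mealy i) w : mstate M := foldl (@mup i M) (minit M) w.

Definition induces i (M : mealy i) (s : strategy i) :=
  forall w v (vi : owner v = i), is_history (rcons w v) ->
    s (rcons w v) = mnxt (mup_hat M w) vi.

Definition finite_memory i (s : strategy i) := exists M : mealy i, induces M s.

Definition memory_at_most i (s : strategy i) (b : nat) :=
  exists M : mealy i, induces M s /\ #|mstate M| <= b.

Definition safe (T : set A) : set (nat -> A) :=
  [set pi | is_play pi /\ forall l, ~ T (pi l)]%classic.

Definition nash_equilibrium (Obj : 'I_n -> set (nat -> A)) (s : profile) v0 :=
  forall i, ~ Obj i (outcome s v0) ->
    ~ exists t : strategy i, Obj i (outcome (dfwith s t) v0).

Definition SatPl (T : 'I_n -> set A) pi : {set 'I_n} :=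
  [set i | `[< safe (T i) pi >]]%SET.

Definition VisPos (T : 'I_n -> set A) pi : set nat :=
  [set l | exists i, T i (pi l) /\ forall k, k < l -> ~ T i (pi k)]%classic.

Lemma finite_VisPos (T : 'I_n -> set A) pi : finite_set (VisPos T pi).
Proof.
pose first i l := T i (pi l) /\ forall k, k < l -> ~ T i (pi k).
have first_inj i l l' : first i l -> first i l' -> l = l'.
  move=> [Tl ltl] [Tl' ltl']; case: (ltngtP l l') => // lt_l.
  - by case: (ltl' _ lt_l).
  - by case: (ltl _ lt_l).
have -> : VisPos T pi = (\bigcup_(i in [set: 'I_n]) first i)%classic.
  by apply/seteqP; split=> l /= [i]; [exists i | exists i].
apply: bigcup_finite => // i _.
case: (pselect (exists l, first i l)) => [[l fl]|nf].
- apply: (sub_finite_set _ (finite_set1 l)) => l' fl' /=.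
  exact: first_inj fl' fl.
- apply: (sub_finite_set _ (finite_set0 nat)) => l' fl' /=.
  by apply: nf; exists l'.
Qed.

Lemma play_from v : exists pi, is_play pi /\ pi 0 = v.
Proof.
pose next u := projT1 (cid (@edge_total n A u)).
exists (fun k => iter k next v); split=> // l /=.
exact: (projT2 (cid (@edge_total n A _))).
Qed.

Lemma play_splice pi l u : is_play pi -> edge (pi l) u ->
  exists pi', is_play pi' /\ mkseq pi' l.+2 = rcons (mkseq pi l.+1) u.
Proof.
move=> pi_play lu; have [rho [rho_play rho0]] := play_from u.
exists (fun k => if k <= l then pi k else rho (k - l.+1)); split.
- move=> k; case: (ltngtP k l) => [_|kl|->].
  + exact: pi_play.
  + by rewrite subSn.
  + by rewrite subnn rho0.
- rewrite mkseqS ltnn subnn rho0; congr (rcons _ u).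
  apply/eq_in_map => k.
  by rewrite mem_iota ltnS => /andP[_ ->].
Qed.

Lemma outcome_historyE (s : profile) v0 l :
  outcome_history s v0 l = mkseq (outcome s v0) l.+1.
Proof.
elim: l => [//|l IH].
rewrite mkseqS -IH.
by rewrite /outcome /= last_rcons.
Qed.

Lemma outcome_history_prefix (s : profile) v0 l :
  is_history (outcome_history s v0 l).
Proof.
suff [pi [pi_play e]] : exists pi,
    is_play pi /\ mkseq pi l.+1 = outcome_history s v0 l by exists pi, l.
elim: l => [|l [pi [pi_play IH]]] /=.
  by have [pi [pi_play pi0]] := play_from v0; exists pi; rewrite /mkseq /= pi0.
rewrite -IH; apply: play_splice => //.
have e : last v0 (mkseq pi l.+1) = pi l by rewrite mkseqS last_rcons.
rewrite e mkseqS; apply: strategyP => //.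
by exists pi, l; rewrite mkseqS.
Qed.

Lemma outcomeS (s : profile) v0 l :
  outcome s v0 l.+1
  = s (owner (outcome s v0 l)) (mkseq (outcome s v0) l.+1).
Proof. by rewrite -outcome_historyE {1}/outcome /= last_rcons. Qed.

Lemma outcome_play (s : profile) v0 : is_play (outcome s v0).
Proof.
move=> l; rewrite outcomeS mkseqS; apply: strategyP => //.
by rewrite -mkseqS -outcome_historyE; exact: outcome_history_prefix.
Qed.

Lemma outcomeP (s : profile) v0 pi :
  [/\ is_play pi, pi 0 = v0 & forall i, consistent (s i) pi]
  <-> pi = outcome s v0.
Proof.
split=> [[_ pi0 pis]|->]; last first.
  split=> // [|i l <-]; first exact: outcome_play.
  exact: outcomeS.
suff H l : mkseq pi l.+1 = mkseq (outcome s v0) l.+1.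
  apply/funext => l; have := congr1 (last v0) (H l).
  by rewrite !mkseqS !last_rcons.
elim: l => [|l IH]; first by rewrite /mkseq /= pi0.
have e : pi l = outcome s v0 l.
  by have := congr1 (last v0) IH; rewrite !mkseqS !last_rcons.
rewrite mkseqS [RHS]mkseqS IH outcomeS -IH -e; congr rcons.
exact: pis.
Qed.

End Arena.

(* Main.v *)
Require Import Defs.
From mathcomp Require Import all_boot finmap.
From mathcomp Require Import boolp classical_sets functions cardinality.

(* A play is the outcome of a Nash equilibrium as soon as, for every losing
   player i, all its vertices up to the first visit to T_i lie in the set from
   which the other players can force a visit to T_i (the attractor of T_i), since
   a deviating player can then be punished by a memoryless attractor strategy.
   Among such plays satisfying at least SatPl(pi'), take one satisfying as many
   players as possible and then with the earliest last position in VisPos. The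
   positions in VisPos cut it into segments. Before the last segment, the only
   edges between vertices of the same segment are those of the play: a forward
   chord would be a shortcut making the last visit earlier, and a backward chord
   closes a loop in which the players whose targets were not visited yet win too.
   Hence leaving the play is always noticed by a machine that only knows the
   current segment and the loser who owned the last vertex. In the last segment
   every loser has already lost, so it suffices to stay on vertices of the play. *)

Set Implicit Arguments.
Unset Strict Implicit.
Unset Printing Implicit Defensive.

Local Open Scope classical_set_scope.

(** * Transfinite iteration and induction on ranks *)

(* The stages of the transfinite iteration of an inflationary F, without ordinals;
   as in the Bourbaki-Witt theorem they are linearly ordered, so each point has a
   largest stage avoiding it, which serves as its rank. *)
Section Tower.
Variables (U : Type) (F : set U -> set U).
Hypothesis F_infl : forall X, X `<=` F X.

Inductive tower : set U -> Prop :=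
| tower_step X : tower X -> tower (F X)
| tower_union (C : set (set U)) : C `<=` tower -> tower (\bigcup_(X in C) X).

(** As in Bourbaki-Witt: no stage strictly inside [X] jumps past [X] in one step. *)
Definition extremal X := forall Y, tower Y -> Y `<=` X -> Y <> X -> F Y `<=` X.

Lemma extremal_cmp X Y : extremal X -> tower Y -> Y `<=` X \/ F X `<=` Y.
Proof.
move=> extX; elim=> {Y} [Y tY [YX|FXY]|C _ IH].
- have [->|ne] := pselect (Y = X); first by right.
  by left; apply: extX.
- by right; apply: (subset_trans FXY); apply: F_infl.
- have [[Y CY FXY]|nC] := pselect (exists2 Y, C Y & F X `<=` Y).
    by right=> x /FXY Yx; exists Y.
  left=> x [Y CY Yx]; case: (IH _ CY) => [YX|FXY]; first exact: YX.
  by case: nC; exists Y.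
Qed.

Lemma tower_extremal X : tower X -> extremal X.
Proof.
elim=> {X} [X tX extX|C tC extC] Y tY Ysub Yne.
  case: (extremal_cmp extX tY) => [YX|FXY].
    have [->//|ne] := pselect (Y = X).
    by apply: subset_trans (F_infl (X := X)); apply: extX.
  by case: Yne; apply/seteqP.
have [[X CX nXY]|nC] := pselect (exists2 X, C X & ~ (X `<=` Y)); last first.
  case: Yne; apply/seteqP; split=> // x [X CX Xx].
  by apply: contrapT => nYx; case: nC; exists X => // XY; exact/nYx/XY.
case: (extremal_cmp (extC _ CX) tY) => [YX|FXY]; last first.
  by case: nXY; apply: subset_trans FXY; apply: F_infl.
apply: (@subset_trans _ X); last by move=> x Xx; exists X.
by apply: extC => // e; apply: nXY; rewrite e.
Qed.

Lemma tower_cmp X Y : tower X -> tower Y -> Y `<=` X \/ F X `<=` Y.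
Proof. by move=> /tower_extremal/extremal_cmp; apply. Qed.

Definition tower_top : set U := \bigcup_(X in tower) X.

Lemma tower_top_closed : F tower_top `<=` tower_top.
Proof.
by move=> x Fx; exists (F tower_top) => //; apply/tower_step/tower_union.
Qed.

Definition tower_below x : set U := \bigcup_(X in [set X | tower X /\ ~ X x]) X.

Lemma tower_belowP x : tower (tower_below x).
Proof. by apply: tower_union => X []. Qed.

Lemma notin_tower_below x : ~ tower_below x x.
Proof. by case=> X []. Qed.

(** Otherwise [F] maps [tower_below x] to a stage still avoiding [x], hence into itself, and the
    iteration stops there before reaching [x]. *)
Lemma in_F_tower_below x : tower_top x -> F (tower_below x) x.
Proof.
case=> X tX Xx; apply: contrapT => nF.
have FB : F (tower_below x) `<=` tower_below x.
  by move=> y Fy; exists (F (tower_below x)) => //; split=> //;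
    apply/tower_step/tower_belowP.
suff XB : X `<=` tower_below x by exact: (notin_tower_below (XB _ Xx)).
case: (tower_cmp (tower_belowP x) tX) => // FBX.
elim: tX {Xx FBX} => {X} [X tX XB|C tC IH].
  case: (tower_cmp tX (tower_belowP x)) => // BX.
  by have -> : X = tower_below x by apply/seteqP.
by move=> y [Y CY]; apply: IH.
Qed.

(** Induction on the rank: when [x] enters in the step from [X] to [F X], comparability puts
    [tower_below x] inside [X]. *)
Lemma tower_top_ind (P : set U) :
  (forall x, tower_top x -> tower_below x `<=` P -> P x) -> tower_top `<=` P.
Proof.
move=> IP x [X tX]; elim: tX x => {X} [X tX IH x Fx|C tC IH x [X CX]]; last first.
  exact: IH.
have [/IH//|nXx] := pselect (X x).
apply: IP; first by exists (F X) => //; exact: tower_step.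
move=> y By; apply: IH.
case: (tower_cmp tX (tower_belowP x)) => [|FXB]; first exact.
by case: (notin_tower_below (FXB _ Fx)).
Qed.

End Tower.

(** * Attractors and memoryless attractor strategies *)

Section Attractor.
Variables (n : nat) (A : arena n) (i : 'I_n) (T : set A).

(** Player [i] plays against the coalition of all others, which wants to reach [T]. *)
Definition attract_step (X : set A) : set A := fun v =>
  [\/ X v, T v, owner v = i /\ forall w, edge v w -> X w
    | owner v <> i /\ exists2 w, edge v w & X w].

Lemma attract_step_infl X : X `<=` attract_step X.
Proof. by move=> v; apply: Or41. Qed.

Definition attractor : set A := tower_top attract_step.

Lemma target_attractor : T `<=` attractor.
Proof. by move=> v Tv; apply: tower_top_closed; apply: Or42. Qed.

Lemma attractor_step v : attract_step attractor v -> attractor v.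
Proof. exact: tower_top_closed. Qed.

(** Stated for every vertex, so that a move can be chosen everywhere; in the attractor outside [T],
    the coalition's move lowers the rank. *)
Lemma attractP v : exists w, edge v w /\
  (attractor v -> ~ T v -> owner v <> i -> tower_below attract_step v w).
Proof.
have [[w vw Bw]|nw] := pselect (exists2 w, edge v w &
  tower_below attract_step v w); first by exists w.
have [w vw] := edge_total v; exists w; split=> // Wv nTv vi.
by case: (in_F_tower_below attract_step_infl Wv) => [Bv|//|[]//|[]//];
  case: (notin_tower_below Bv).
Qed.

Definition attract_move v : A := projT1 (cid (attractP v)).

Lemma attract_move_edge v : edge v (attract_move v).
Proof. by rewrite /attract_move; case: cid => w []. Qed.

Lemma attractor_own v w : attractor v -> ~ T v -> owner v = i -> edge v w ->
  tower_below attract_step v w.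
Proof.
move=> Wv nTv vi vw.
case: (in_F_tower_below attract_step_infl Wv) => [Bv|//|[_]|[]//]; last exact.
by case: (notin_tower_below Bv).
Qed.

Lemma tower_below_attractor v : tower_below attract_step v `<=` attractor.
Proof. by move=> w [X [tX _] Xw]; exists X. Qed.

(** While [T] is avoided, each move enters an earlier stage, so induction on the rank excludes every
    vertex of the attractor. *)
Lemma attract_move_reaches pi : is_play pi -> attractor (pi 0) ->
  (forall l, owner (pi l) <> i -> pi l.+1 = attract_move (pi l)) ->
  exists l, T (pi l).
Proof.
move=> pi_play W0 pi_move; apply: contrapT => nT.
suff H v : attractor v -> forall l, pi l <> v by exact: (H _ W0 0).
move: v; apply: (tower_top_ind attract_step_infl
  (P := fun v => forall l, pi l <> v)) => v Wv IH l e.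
suff : tower_below attract_step v (pi l.+1) by move=> /IH /(_ l.+1).
have nTv : ~ T v by rewrite -e => Tv; apply: nT; exists l.
have [vi|vi] := pselect (owner v = i).
  by apply: attractor_own => //; rewrite -e.
rewrite pi_move ?e // /attract_move; case: cid => w [_] /=; exact.
Qed.

End Attractor.

(** * First visits, Nash plays and segments *)

Section NashPlays.
Variables (n : nat) (A : arena n) (T : 'I_n -> set A).
Implicit Types (pi : nat -> A) (i : 'I_n).

Definition first_visit pi i p := T i (pi p) /\ forall k, k < p -> ~ T i (pi k).

Lemma first_visit_exists pi i l : T i (pi l) ->
  exists2 p, p <= l & first_visit pi i p.
Proof.
move=> Tl; have ex : exists l, `[< T i (pi l) >] by exists l; apply/asboolP.
case: (ex_minnP ex) => p /asboolP Tp minp; exists p.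
  exact/minp/asboolP.
split=> // k kp /asboolP Tk; by move: (minp _ Tk); rewrite leqNgt kp.
Qed.

Lemma first_visit_uniq pi i p q :
  first_visit pi i p -> first_visit pi i q -> p = q.
Proof.
move=> [Tp ltp] [Tq ltq]; case: (ltngtP p q) => // lt_pq.
- by case: (ltq _ lt_pq).
- by case: (ltp _ lt_pq).
Qed.

Lemma SatPlP pi i : is_play pi ->
  reflect (forall l, ~ T i (pi l)) (i \in SatPl T pi).
Proof.
by move=> pi_play; rewrite inE; apply: (iffP (asboolP _)) => [[]|].
Qed.

Definition visits pi : seq nat := fset_set (VisPos T pi `\ 0).

Lemma visits_uniq pi : uniq (visits pi).
Proof. exact: fset_uniq. Qed.

Lemma mem_visits pi p : p \in visits pi <-> VisPos T pi p /\ p <> 0.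
Proof.
rewrite /visits in_fset_set; first by split=> [/set_mem|?]; rewrite ?inE.
exact/finite_setD/finite_VisPos.
Qed.

Lemma size_visits pi : size (visits pi) <= n.
Proof.
have visitor p : exists o, p \in visits pi ->
    exists2 i, o = Some i & first_visit pi i p.
  case: (boolP (p \in visits pi)) => [/mem_visits[[i fi] _]|_]; last by exists None.
  by exists (Some i) => _; exists i.
have [f fP] := choice visitor.
apply: (@leq_trans (size (map Some (enum 'I_n)))); last first.
  by rewrite size_map size_enum_ord.
rewrite -(size_map f); apply: uniq_leq_size.
  rewrite map_inj_in_uniq ?visits_uniq // => p q /fP[i -> fp] /fP[j -> fq] [ij].
  by apply: (first_visit_uniq fp); rewrite ij.
by move=> _ /mapP[p /fP[i -> _] ->]; apply: map_f; rewrite mem_enum.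
Qed.

(** A satisfied player has no first visit, so only losers are constrained. *)
Definition nash_play pi := is_play pi /\
  forall i p k, first_visit pi i p -> k <= p -> attractor i (T i) (pi k).

(** A loser whose play leaves the attractor before the first visit could stay outside it forever,
    and so avoid the target. *)
Lemma nash_play_outcome (s : profile A) v0 :
  nash_equilibrium (fun i => safe (T i)) s v0 -> nash_play (outcome s v0).
Proof.
move=> s_nash; set pi := outcome s v0; split; first exact: outcome_play.
move=> i p k [Tp ltp] kp; apply: contrapT => nWk.
have esc v : exists w, edge v w /\
  (owner v = i -> ~ attractor i (T i) v -> ~ attractor i (T i) w).
  have [[w vw nWw]|nw] := pselect (exists2 w, edge v w & ~ attractor i (T i) w).
    by exists w.
  have [w vw] := edge_total v; exists w; split=> // vi; apply: contra_not => _.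
  apply: attractor_step; apply: Or43; split=> // u vu.
  by apply: contrapT => nWu; apply: nw; exists u.
have [e eP] := choice esc.
(* Copying [s i] inside the attractor makes the deviating play follow [pi] up to its first vertex
   outside, [pi m]; from there no move re-enters. *)
pose tf h := if `[< attractor i (T i) (last v0 h) >] then s i h
             else e (last v0 h).
have tfP w v : is_history (rcons w v) -> owner v = i -> edge v (tf (rcons w v)).
  move=> hist vi; rewrite /tf last_rcons; case: asboolP => _; last by case: (eP v).
  exact: strategyP.
pose t := Strategy tfP.
apply: (s_nash i).
  by move=> [_ /(_ p)].
exists t; set rho := outcome _ _.
have rho_play : is_play rho by exact: outcome_play.
have exk : exists k, `[< ~ attractor i (T i) (pi k) >] by exists k; apply/asboolP.
case: (ex_minnP exk) => m /asboolP nWm minm.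
have mp : m <= p by apply: leq_trans kp; apply: minm; apply/asboolP.
have rhoS l : rho l.+1 = dfwith s t (owner (rho l)) (mkseq rho l.+1).
  exact: outcomeS.
have agree l : l <= m -> mkseq rho l.+1 = mkseq pi l.+1.
  elim: l => [//|l IH lm]; rewrite mkseqS [RHS]mkseqS.
  have el := IH (ltnW lm); rewrite el; congr rcons.
  have epl : rho l = pi l.
    by have := congr1 (last v0) el; rewrite !mkseqS !last_rcons.
  rewrite rhoS el epl [RHS]outcomeS -/pi.
  case: dfwithP => //=; rewrite /tf mkseqS last_rcons; case: asboolP => // nWl.
  by move: lm; rewrite ltnNge minm //; apply/asboolP.
have agree1 l : l <= m -> rho l = pi l.
  by move=> /agree /(congr1 (last v0)); rewrite !mkseqS !last_rcons.
have out l : ~ attractor i (T i) (rho (m + l)).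
  elim: l => [|l IH]; first by rewrite addn0 agree1.
  have [vi|vi] := pselect (owner (rho (m + l)) = i).
    rewrite addnS rhoS vi dfwith_in /= /tf mkseqS last_rcons.
    by case: asboolP => // _; case: (eP (rho (m + l))) => _; apply.
  rewrite addnS => W; apply: IH; apply: attractor_step; apply: Or44; split=> //.
  by exists (rho (m + l).+1).
split=> // l; case: (leqP m l) => [ml|lm].
  by rewrite -(subnKC ml) => Tl; apply: (out (l - m)); exact: target_attractor.
rewrite agree1 1?ltnW //; apply: ltp; exact: leq_trans mp.
Qed.

(* The shortcut and the loop are both obtained by reindexing the positions of the
   play. *)
Section Reindex.
Variables (pi : nat -> A) (f : nat -> nat).
Hypothesis f0 : f 0 = 0.
Let rho := pi \o f.
Hypothesis rho_play : is_play rho.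
(** Monotonicity is asked only up to a first visit, since the loop later jumps back. *)
Hypothesis f_first : forall i p, first_visit rho i p ->
  first_visit pi i (f p) /\ forall k, k <= p -> f k <= f p.

Lemma reindex_nash_play : nash_play pi -> nash_play rho.
Proof.
move=> [pi_play piP]; split=> // i p k /f_first[fp mon] kp.
exact: (piP _ _ _ fp (mon _ kp)).
Qed.

Lemma reindex_Sat : is_play pi -> SatPl T pi \subset SatPl T rho.
Proof.
move=> pi_play; apply/fintype.subsetP => i /SatPlP nT.
by apply/SatPlP => // l; apply: nT.
Qed.

Lemma reindex_visits p : p \in visits rho -> f p \in visits pi.
Proof.
move=> /mem_visits[[i /[dup] fp /f_first[fp' mon]] p0]; apply/mem_visits.
split; first by exists i.
move=> fp0; case: fp => _ /(_ 0); rewrite lt0n; move/eqP: p0 => p0 /(_ p0).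
by rewrite /rho /= f0 -fp0; case: fp'.
Qed.

(** [f] is injective on visits: two positions with one image carry the same vertex, so the later one
    is no first visit. *)
Lemma reindex_size_visits : size (visits rho) <= size (visits pi).
Proof.
rewrite -(size_map f); apply: uniq_leq_size; last first.
  by move=> _ /mapP[p /reindex_visits ? ->].
rewrite map_inj_in_uniq ?visits_uniq // => p q.
wlog pq : p q / p <= q => [H|].
  by case/orP: (leq_total p q) => ? ? ? ?; [|symmetry]; apply: H.
move=> /mem_visits[[i [Ti _]] _] /mem_visits[[j [Tj ltj]] _] fpq.
move: pq; rewrite leq_eqVlt => /orP[/eqP //|/ltj].
by case; rewrite /rho /= fpq.
Qed.

End Reindex.

(* The number of completed segments before position m is read: a visit at m itself
   is not counted. *)
Definition segment pi m := count (fun q => q < m) (visits pi).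

Lemma segment0 pi : segment pi 0 = 0.
Proof. exact: count_pred0. Qed.

Lemma segment_le pi m : segment pi m <= size (visits pi).
Proof. exact: count_size. Qed.

Lemma segment_lt pi m :
  segment pi m < size (visits pi) <-> exists2 q, q \in visits pi & m <= q.
Proof.
rewrite ltn_neqAle segment_le andbT -all_count -has_predC.
split=> [/hasP[q qv /=]|[q qv mq]].
  by rewrite -leqNgt => mq; exists q.
by apply/hasP; exists q => //=; rewrite -leqNgt.
Qed.

(** If [q < m], then [m] counts [q] and all that [l] counts, while [l] does not count [q]. *)
Lemma segment_eq pi l m q : segment pi l = segment pi m -> q \in visits pi ->
  l <= q -> m <= q.
Proof.
move=> e qv lq; rewrite leqNgt; apply/negP => qm.
have lm := leq_ltn_trans lq qm.
suff : segment pi l < segment pi m by rewrite e ltnn.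
have -> : segment pi l = count (fun q => q < l) [seq q <- visits pi | q < m].
  rewrite count_filter; apply: eq_count => k /=.
  by case: (ltnP k l) => // kl; rewrite (ltn_trans kl lm).
rewrite /segment -[ltnRHS]size_filter ltn_neqAle count_size andbT -all_count -has_predC.
by apply/hasP; exists q; rewrite ?mem_filter ?qm //= -leqNgt.
Qed.

(** The segment of [l.+1], not of [l], is what the machine knows after reading [pi l]. The last
    segment is exempt: every loser has lost by then. *)
Definition chordless pi := forall l m,
  segment pi l.+1 = segment pi m -> segment pi m < size (visits pi) ->
  edge (pi l) (pi m) -> m = l.+1.

(** A repetition yields a chord: the predecessor of the later occurrence has an edge to the earlier
    one. *)
Lemma chordless_inj pi l m : is_play pi -> chordless pi ->
  segment pi l = segment pi m -> segment pi m < size (visits pi) ->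
  pi l = pi m -> l = m.
Proof.
move=> pi_play chl; wlog lm : l m / l < m => [H|].
  case: (ltngtP l m) => // lm e; first exact: H.
  by rewrite -e => ? ?; symmetry; apply: H.
case: m lm => // m lm e k plm; apply: (chl m l) => //; first by rewrite e.
by rewrite plm; apply: pi_play.
Qed.


(** * Removing chords by shortcuts and loops *)

Definition last_visit pi := \max_(q <- visits pi) q.

(** The last clause makes the search terminate; the bound on [visits] preserves the memory bound. *)
Definition improves pi rho :=
  [/\ nash_play rho, rho 0 = pi 0, SatPl T pi \subset SatPl T rho,
      size (visits rho) <= size (visits pi)
    & SatPl T pi \proper SatPl T rho \/ last_visit rho < last_visit pi].

(** No first visit is skipped, because [l.+1] and [m] lie in the same segment; all later ones, such
    as [q0], move earlier. *)
Lemma shortcut_improves pi l m : nash_play pi -> edge (pi l) (pi m) ->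
  l.+1 < m -> segment pi l.+1 = segment pi m ->
  segment pi m < size (visits pi) -> exists rho, improves pi rho.
Proof.
move=> pi_nash lm l1m seg /segment_lt[q0 q0v mq0].
have [pi_play _] := pi_nash.
pose f t := if t <= l then t else t + (m - l.+1).
have fle t : t <= l -> f t = t by rewrite /f => ->.
have fgt t : l < t -> f t = t + (m - l.+1) by rewrite /f ltnNge => /negbTE ->.
have rho_play : is_play (pi \o f).
  move=> t /=; case: (ltngtP t l) => tl.
  - by rewrite !fle // ltnW.
  - by rewrite !fgt ?addSn // ltnW.
  - by rewrite tl fle // fgt // subnKC // ltnW.
have f_first i p : first_visit (pi \o f) i p ->
    first_visit pi i (f p) /\ forall k, k <= p -> f k <= f p.
  move=> [/= Tp ltp]; split; last first.
    move=> k kp; case: (leqP p l) => pl.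
      by rewrite !fle // (leq_trans kp).
    rewrite (fgt p) //; case: (leqP k l) => kl; last by rewrite fgt ?leq_add2r.
    by rewrite fle // (leq_trans kp) // leq_addr.
  split=> // k kfp Tk; have [q qk fq] := first_visit_exists Tk.
  have [Tq ltq] := fq; have qfp := leq_ltn_trans qk kfp.
  case: (leqP q l) => ql.
    apply: (ltp q); last by rewrite fle.
    by move: qfp; rewrite /f; case: (leqP p l) => // pl _; exact: leq_ltn_trans pl.
  have qv : q \in visits pi.
    by apply/mem_visits; split; [exists i | case: (q) ql].
  have mq := segment_eq seg qv ql.
  have dq : m - l.+1 <= q by apply: leq_trans mq; apply: leq_subr.
  have lq : l < q - (m - l.+1) by rewrite ltn_subRL -addnS subnK // ltnW.
  apply: (ltp (q - (m - l.+1))); last by rewrite fgt // subnK.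
  have lp : l < p.
    rewrite ltnNge; apply/negP => pl; move: qfp; rewrite fle // => qp.
    by move: (ltn_trans ql qp); rewrite ltnNge pl.
  by rewrite ltn_subLR // addnC -fgt.
have f0 : f 0 = 0 by rewrite fle.
exists (pi \o f); split; [exact: reindex_nash_play|by rewrite /= f0|
  exact: reindex_Sat|exact: reindex_size_visits|right].
have q0max : q0 <= last_visit pi by apply: leq_bigmax_seq.
(* Positivity turns the strict bound on a maximum into a termwise bound by the predecessor, which
   also covers an empty [visits]. *)
have last_gt0 : 0 < last_visit pi.
  by apply: leq_trans q0max; apply: leq_trans mq0; apply: leq_trans l1m.
rewrite -[ltnRHS]prednK // ltnS; apply/bigmax_leqP_seq => q qv _.
rewrite -ltnS prednK //; have fqv := reindex_visits f0 f_first qv.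
case: (leqP q l) => ql.
  by apply: leq_trans q0max; apply: leq_trans mq0; apply: leq_ltn_trans ql _;
    apply: ltnW.
apply: (@leq_trans (f q)); last exact: leq_bigmax_seq.
by rewrite fgt // -addn1 leq_add2l subn_gt0.
Qed.

(** Repeating positions [m] to [l] forever keeps all winners, and a player first losing at some [q0]
    after [l] now wins as well. *)
Lemma loop_improves pi l m : nash_play pi -> edge (pi l) (pi m) ->
  m <= l -> segment pi l.+1 < size (visits pi) -> exists rho, improves pi rho.
Proof.
move=> pi_nash lm ml /segment_lt[q0 q0v lq0].
have [pi_play _] := pi_nash.
pose c := l.+1 - m; have c0 : 0 < c by rewrite subn_gt0.
pose f t := if t < m then t else m + (t - m) %% c.
have flt t : t < m -> f t = t by rewrite /f => ->.
have fge t : m <= t -> f t = m + (t - m) %% c by rewrite /f leqNgt => /negbTE ->.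
have fle_l t : f t <= l.
  case: (ltnP t m) => tm; first by rewrite flt // (leq_trans (ltnW tm)).
  by rewrite fge // -ltnS -[ltnRHS](subnKC (leq_trans ml (leqnSn l)))
    ltn_add2l ltn_mod.
have f_id t : t <= l -> f t = t.
  move=> tl; case: (ltnP t m) => tm; first exact: flt.
  by rewrite fge // modn_small ?subnKC // ltn_sub2r // (leq_ltn_trans ml).
have rho_play : is_play (pi \o f).
  move=> t /=; case: (ltnP t l) => tl; first by rewrite !f_id ?(ltnW tl).
  have mt := leq_trans ml tl.
  rewrite (fge t.+1) ?(leq_trans mt) // subSn // modnS fge //.
  case: ifP => [dv|_]; last by rewrite addnS; apply: pi_play.
  rewrite addn0; suff -> : m + (t - m) %% c = l by [].
  have : (((t - m) %% c).+1 == 0 %[mod c]).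
    by rewrite -addn1 modnDml addn1 mod0n; move: dv; rewrite /dvdn.
  rewrite mod0n -/(dvdn _ _) => /(dvdn_leq (ltn0Sn _)) cle.
  have -> : (t - m) %% c = c.-1.
    by apply/eqP; rewrite -eqSS prednK // eqn_leq cle ltn_mod c0.
  by rewrite /c subSn //= subnKC.
(* After [l], every vertex already occurred at a position at most [l], where [f] is the identity. *)
have first_le i p : first_visit (pi \o f) i p -> p <= l.
  move=> [/= Tp ltp]; rewrite leqNgt; apply/negP => lp.
  apply: (ltp (f p)); first exact: leq_ltn_trans lp.
  by rewrite (f_id (f p)).
have f_first i p : first_visit (pi \o f) i p ->
    first_visit pi i (f p) /\ forall k, k <= p -> f k <= f p.
  move=> fp; have pl := first_le _ _ fp; case: fp => /= Tp ltp.
  rewrite !f_id //; split=> [|k kp]; last by rewrite f_id // (leq_trans kp).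
  split=> [|k kp]; first by rewrite -{1}(f_id p).
  by have := ltp _ kp; rewrite /= f_id // ltnW // (leq_trans kp).
have f0 : f 0 = 0 by rewrite f_id.
have sub := reindex_Sat rho_play pi_play.
exists (pi \o f); split=> //; [exact: reindex_nash_play|by rewrite /= f0|
  exact: reindex_size_visits|left].
have /mem_visits[[i [Tq ltq]] _] := q0v.
apply/properP; split=> //; exists i.
  by apply/SatPlP => // t /=; apply: ltq; apply: leq_ltn_trans lq0.
by apply/SatPlP => // /(_ q0); apply.
Qed.

Lemma chordless_or_improves pi : nash_play pi ->
  chordless pi \/ exists rho, improves pi rho.
Proof.
move=> pi_nash; have [|nimp] := pselect (exists rho, improves pi rho); first by right.
left=> l m seg segk lm; apply: contrapT => /eqP ne; apply: nimp.
move: ne; rewrite neq_ltn => /orP[ml|lm1]; last exact: (shortcut_improves pi_nash lm).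
by apply: (loop_improves pi_nash lm) => //; rewrite seg.
Qed.

(** Lexicographic descent on the number of losers, then on the last visit. *)
Lemma exists_chordless pi : nash_play pi -> exists rho,
  [/\ nash_play rho, rho 0 = pi 0, SatPl T pi \subset SatPl T rho,
      size (visits rho) <= size (visits pi) & chordless rho].
Proof.
have [N] := ubnP (n - #|SatPl T pi|); elim: N pi => // N IHN pi.
have [B] := ubnP (last_visit pi); elim: B pi => // B IHB pi piB piN pi_nash.
case: (chordless_or_improves pi_nash) => [chl|[rho [rho_nash rho0 sub sz dec]]].
  by exists pi.
suff [tau [? tau0 subt szt ?]] : exists tau,
  [/\ nash_play tau, tau 0 = rho 0, SatPl T rho \subset SatPl T tau,
      size (visits tau) <= size (visits rho) & chordless tau].
  by exists tau; split; rewrite ?tau0 //;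
    [exact: fintype.subset_trans sub subt|exact: leq_trans szt sz].
case: dec => [/proper_card lt|lt]; last first.
  apply: IHB => //; first by rewrite -ltnS; apply: leq_trans piB.
  by apply: leq_ltn_trans piN; rewrite leq_sub2l // subset_leq_card.
apply: IHN => //; move: piN; rewrite !ltnS; apply: leq_trans.
apply: ltn_sub2l => //; apply: leq_trans lt _.
by rewrite -[leqRHS]card_ord max_card.
Qed.

End NashPlays.

(** * The punishing Mealy machine *)

Section Machine.
Variables (n : nat) (A : arena n) (T : 'I_n -> set A) (pi : nat -> A).
Hypotheses (pi_nash : nash_play T pi) (pi_chordless : chordless T pi).
(** May contain a winner, so that [i0] exists even when nobody loses. *)
Variable losers : {set 'I_n}.
Hypothesis not_losers : forall i, i \notin losers -> i \in SatPl T pi.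
Variable i0 : {i | i \in losers}.

Let k := size (visits T pi).
Let pi_play : is_play pi. Proof. by case: pi_nash. Qed.

(** Before the last segment the position is unique by [chordless_inj]; in the last one any
    occurrence will do. *)
Definition segment_position j v : option nat :=
  if pselect (exists m, segment T pi m = j /\ pi m = v) is left e
  then Some (projT1 (cid e)) else None.

Lemma segment_positionP j v m : segment_position j v = Some m ->
  segment T pi m = j /\ pi m = v.
Proof.
by rewrite /segment_position; case: pselect => // e [<-]; case: cid.
Qed.

Lemma segment_position_None j v m : segment_position j v = None ->
  segment T pi m = j -> pi m <> v.
Proof.
rewrite /segment_position; case: pselect => [//|ne _ sm pm].
by case: ne; exists m.
Qed.

Lemma segment_position_ex m : exists m',
  [/\ segment_position (segment T pi m) (pi m) = Some m',
      segment T pi m' = segment T pi m & pi m' = pi m].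
Proof.
case e : segment_position => [m'|].
  by have [? ?] := segment_positionP e; exists m'.
by case: (segment_position_None e erefl).
Qed.

(* In a state (i, j) with j <= k, the vertex to be read next is expected on the
   j-th segment of pi, and i is the owner of the last vertex if it is a loser;
   (i, k.+1) means that i is being punished. *)
Definition punish_state : finType := ({i | i \in losers} * 'I_k.+2)%type.

Definition punish_init : punish_state := (i0, ord0).

(** An owner outside [losers] is recorded as [i0]: it wins anyway and needs no punishment. No
    position has segment [k.+1], so punishment never ends. *)
Definition punish_up (st : punish_state) (v : A) : punish_state :=
  if segment_position st.2 v is Some m
  then (insubd i0 (owner v), inord (segment T pi m.+1))
  else (st.1, ord_max).

Definition punish_next (st : punish_state) (v : A) : A :=
  if segment_position st.2 v is Some m then pi m.+1
  else attract_move (val st.1) (T (val st.1)) v.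

Lemma punish_next_edge st v : edge v (punish_next st v).
Proof.
rewrite /punish_next; case e : segment_position => [m|].
  by have [_ <-] := segment_positionP e; apply: pi_play.
exact: attract_move_edge.
Qed.

Definition punish_memory w := foldl punish_up punish_init w.

Definition punish_fun h :=
  punish_next (punish_memory (take (size h).-1 h)) (last (pi 0) h).

Lemma punish_fun_rcons w v :
  punish_fun (rcons w v) = punish_next (punish_memory w) v.
Proof. by rewrite /punish_fun last_rcons size_rcons /= -cats1 take_size_cat. Qed.

Fact punish_funP w v : edge v (punish_fun (rcons w v)).
Proof. by rewrite punish_fun_rcons; apply: punish_next_edge. Qed.

Definition punish_strategy i : strategy A i :=
  Strategy (fun w v _ _ => punish_funP w v).

Definition punish_mealy i : mealy A i :=
  Mealy punish_init punish_up (fun st v _ => punish_next st v).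

Lemma punish_induced i : induces (punish_mealy i) (punish_strategy i).
Proof. by move=> w v vi _; apply: punish_fun_rcons. Qed.

Lemma card_punish_state : #|punish_state| = #|losers| * (k + 2).
Proof. by rewrite card_prod card_ord card_sig addn2. Qed.

Lemma inord_segment m : (inord (segment T pi m) : 'I_k.+2) = segment T pi m :> nat.
Proof. by rewrite inordK // ltnS leqW // segment_le. Qed.

Lemma punish_memory_play rho l : punish_memory (mkseq rho l.+1)
  = punish_up (punish_memory (mkseq rho l)) (rho l).
Proof. by rewrite mkseqS /punish_memory foldl_rcons. Qed.

Let out := outcome punish_strategy (pi 0).

(** In the last segment another occurrence may be chosen and the outcome may leave the order of
    [pi]; staying on its vertices suffices for safety. *)
Lemma punish_outcome l : exists m,
  out l = pi m /\ (punish_memory (mkseq out l)).2 = segment T pi m :> nat.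
Proof.
elim: l => [|l [m [em sm]]]; first by exists 0; rewrite segment0.
have [m' [em' sm' pm']] := segment_position_ex m.
exists m'.+1; split.
  rewrite /out outcomeS -/out /= mkseqS punish_fun_rcons /punish_next.
  by rewrite sm em em'.
by rewrite punish_memory_play /punish_up sm em em' /= inord_segment.
Qed.

Lemma punish_Sat : SatPl T pi \subset SatPl T out.
Proof.
apply/fintype.subsetP => i /SatPlP nT; apply/SatPlP; first exact: outcome_play.
by move=> l; have [m [-> _]] := punish_outcome l; apply: nT.
Qed.

Lemma punish_nash : nash_equilibrium (fun i => safe (T i)) punish_strategy (pi 0).
Proof.
move=> i nsafe [t]; set rho := outcome _ _ => -[rho_play rho_safe].
have iNSat : i \notin SatPl T pi.
  apply/negP => /(fintype.subsetP punish_Sat) /SatPlP; rewrite -/out => iS.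
  by apply: nsafe; split; [exact: outcome_play|apply: iS; exact: outcome_play].
have il : i \in losers by apply: contraNT iNSat => /not_losers.
have [p fp] : exists p, first_visit T pi i p.
  apply: contrapT => nfp; move/negP: iNSat; apply; apply/SatPlP => // l Tl.
  by have [p _ fp] := @first_visit_exists _ _ T pi i l Tl; apply: nfp; exists p.
have rho0 : rho 0 = pi 0 by [].
have rhoS l : owner (rho l) <> i ->
    rho l.+1 = punish_next (punish_memory (mkseq rho l)) (rho l).
  move=> /eqP ne; rewrite {1}/rho outcomeS -/rho dfwith_out 1?eq_sym //=.
  by rewrite mkseqS punish_fun_rcons.
have segk m : m <= p -> 0 < p -> segment T pi m < k.
  move=> mp p0; apply/segment_lt; exists p => //; apply/mem_visits; split.
    by exists i.
  by apply/eqP; rewrite -lt0n.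
have posE m : m <= p -> 0 < p ->
    segment_position (segment T pi m) (pi m) = Some m.
  move=> mp p0; have [m' [-> sm' pm']] := segment_position_ex m; congr Some.
  by apply: (chordless_inj pi_play pi_chordless sm') => //; apply: segk.
(* [d] is the last position before the first disagreement; [d < p], as otherwise [rho] would visit
   [T i] at [p]. *)
have [d [dp ed rhod]] : exists d, [/\ d < p, forall l, l <= d -> rho l = pi l
    & rho d.+1 <> pi d.+1].
  have ex : exists l, `[< rho l <> pi l >].
    apply: contrapT => ne; apply: (rho_safe p); suff -> : rho p = pi p by case: fp.
    by apply: contrapT => nep; apply: ne; exists p; apply/asboolP.
  case: (ex_minnP ex) => -[/asboolP //|d] /asboolP rhod mind.
  have ed l : l <= d -> rho l = pi l.
    move=> ld; apply: contrapT => /asboolP nel.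
    by move: (mind _ nel); rewrite ltnNge ld.
  exists d; split=> //; rewrite ltnNge; apply/negP => pd.
  by apply: (rho_safe p); rewrite ed //; case: fp.
have p0 : 0 < p by apply: leq_ltn_trans dp.
have mem_d l : l <= d ->
    (punish_memory (mkseq rho l)).2 = segment T pi l :> nat.
  elim: l => [|l IH ld]; first by rewrite segment0.
  rewrite punish_memory_play /punish_up IH 1?ltnW // ed 1?ltnW //.
  by rewrite posE ?inord_segment // (leq_trans (ltnW ld)) // ltnW.
have own_d : owner (rho d) = i.
  apply: contrapT => /rhoS; rewrite /punish_next mem_d // (ed d) // posE //.
  exact: ltnW.
have own_d' : owner (pi d) = i by rewrite -ed.
have mem_dS : punish_memory (mkseq rho d.+1)
    = (insubd i0 i, inord (segment T pi d.+1)).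
  by rewrite punish_memory_play /punish_up mem_d // (ed d) // posE // ?own_d' // ltnW.
(* The deviation is noticed at once: a position in the current segment would be the end of a chord
   from [d]. *)
have no_pos : segment_position (segment T pi d.+1) (rho d.+1) = None.
  case e : segment_position => [m|] //; have [sm pm] := segment_positionP e.
  case: rhod; rewrite -pm; congr pi; apply: pi_chordless; first by rewrite sm.
    by rewrite sm; apply: segk.
  by rewrite pm -ed.
have mem_pun l : punish_memory (mkseq rho (d.+2 + l)) = (insubd i0 i, ord_max).
  elim: l => [|l IH].
    by rewrite addn0 punish_memory_play mem_dS /punish_up /= inord_segment no_pos.
  rewrite addnS punish_memory_play IH /punish_up /=.
  case e : segment_position => [m|] //; have [sm _] := segment_positionP e.
  by have := segment_le T pi m; rewrite sm /= -/k ltnn.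
have vali : val (insubd i0 i) = i by rewrite insubdK.
have [] : exists l, T i (rho (d.+1 + l)); last by move=> l /rho_safe.
apply: (@attract_move_reaches _ _ i (T i) (fun l => rho (d.+1 + l))).
- by move=> l; rewrite addnS; apply: rho_play.
(* [pi d] is a vertex of [i] in the attractor and outside [T i], so whichever successor [i] picks is
   still in the attractor. *)
- rewrite addn0; apply: (@tower_below_attractor _ _ _ _ (pi d)).
  apply: attractor_own => //; last by rewrite -ed.
    by case: pi_nash => _ /(_ _ _ _ fp); apply; apply: ltnW.
  by case: fp => _; apply.
- move=> l ne; rewrite addnS rhoS //; case: l {ne} => [|l].
    by rewrite addn0 mem_dS /punish_next /= inord_segment no_pos vali.
  rewrite addnS -addSn mem_pun /punish_next /=.
  case e : segment_position => [m|]; last by rewrite vali.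
  by have [sm _] := segment_positionP e; have := segment_le T pi m;
    rewrite sm /= -/k ltnn.
Qed.

End Machine.

(** * Assembling the equilibrium and counting its memory states *)

Theorem theorem37 (n : nat) (n_ge1 : 1 <= n) (A : arena n)
    (T : 'I_n -> set A) (s' : profile A) (v0 : A)
    (s'_nash : nash_equilibrium (fun i => safe (T i)) s' v0) :
  let pi' := outcome s' v0 in
  let b := maxn 1 (n - #|SatPl T pi'|)
           * (#|` fset_set (VisPos T pi' `\ 0)%classic| + 2) in
  (exists s : profile A,
    [/\ nash_equilibrium (fun i => safe (T i)) s v0,
        forall i, finite_memory (s i),
        SatPl T pi' \subset SatPl T (outcome s v0)
      & forall i, memory_at_most (s i) b])
  /\ b <= n ^ 2 + 2 * n.
Proof.
move=> pi' b; have size_pi' : #|` fset_set (VisPos T pi' `\ 0)%classic|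
  = size (visits T pi') by [].
split; last first.
  rewrite /b size_pi' -mulnn -mulnDl mulnC; apply: leq_mul.
    by rewrite leq_add2r; apply: size_visits.
  by rewrite geq_max n_ge1 leq_subr.
have [pi [pi_nash pi0 sub sz chl]] := exists_chordless (nash_play_outcome s'_nash).
rewrite -/pi' in pi0 sub sz; have pi0v : pi 0 = v0 by rewrite pi0.
(* With no loser, an arbitrary player is added, whence the 1 in the maximum; otherwise [i0] is
   itself a loser and adds nothing. *)
have [i0 i0P] : exists i0 : 'I_n, ~: SatPl T pi = finset.set0 \/ i0 \notin SatPl T pi.
  have [e|[i]] := set_0Vmem (~: SatPl T pi).
    by exists (Ordinal n_ge1); left.
  by rewrite inE => iN; exists i; right.
pose losers := i0 |: ~: SatPl T pi.
have card_losers : #|losers| <= maxn 1 (n - #|SatPl T pi'|).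
  have cardN : #|~: SatPl T pi| <= n - #|SatPl T pi'|.
    rewrite cardsCs finset.setCK card_ord leq_sub2l //; exact: subset_leq_card.
  rewrite leq_max; case: i0P => [e|iN].
    by rewrite /losers e finset.setU0 cards1.
  rewrite /losers (finset.setUidPr _) ?cardN ?orbT //.
  by rewrite finset.sub1set finset.in_setC.
have not_losers i : i \notin losers -> i \in SatPl T pi.
  by rewrite finset.in_setU1 negb_or finset.in_setC negbK => /andP[].
have i0l : i0 \in losers by rewrite finset.in_setU1 eqxx.
pose s := punish_strategy pi_nash (exist _ i0 i0l).
have s_ind i : memory_at_most (s i) b.
  exists (punish_mealy T pi (exist _ i0 i0l) i); split; first exact: punish_induced.
  rewrite card_punish_state /b size_pi'; apply: leq_mul => //.
  by rewrite leq_add2r.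
exists s; split=> //; rewrite -?pi0v.
- exact: punish_nash.
- by move=> i; have [M [? _]] := s_ind i; exists M.
- by apply: fintype.subset_trans sub _; apply: punish_Sat.
Qed.
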